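(* Let $A\in\mathbb{J}\subset\mathbb{R}^{n\times n}$. Suppose $\{(\lambda^c_i,X^c_{i,l})\}_{l=1}^{m_i}$, $\{(\overline{\lambda^c_i},\overline{X^c_{i,l}})\}_{l=1}^{m_i}$ ($i=1,\dots,r$) and $\{(\lambda^c_j,X^c_{j,l})\}_{l=1}^{m_j}$ ($j=2r+1,\dots,p$) are the complete collections of Jordan pairs of $A$ for the eigenvalues $\lambda_i^c\in\mathbb{C}\smallsetminus\mathbb{R}$, $\overline{\lambda_i^c}$ and $\lambda_j^c\in\mathbb{R}$ of $A$, where all the numbers $\lambda_i^c,\overline{\lambda_i^c},\lambda_j^c$ are pairwise distinct. Let $\lambda_i^a\in\mathbb{C}\smallsetminus\mathbb{R}$ ($i=1,\dots,r$) and $\lambda_j^a\in\mathbb{R}$ ($j=2r+1,\dots,p$) be scalars. Put $$X_c=\begin{bmatrix}X_1^c&\cdots&X_r^c&X_{2r+1}^c&\cdots&X_p^c\end{bmatrix},\quad X_i^c=\begin{bmatrix}\hat{X}_i^c&\overline{\hat{X}_i^c}\end{bmatrix},$$ $\hat{X}_i^c=[X^c_{i,1}\ \cdots\ X^c_{i,m_i}]$, $X_j^c=[X^c_{j,1}\ \cdots\ X^c_{j,m_j}]$, and for $s\in\{c,a\}$ $$\Lambda_s=\mathrm{diag}(\Lambda_1^s,\dots,\Lambda_r^s,\Lambda_{2r+1}^s,\dots,\Lambda_p^s),\quad\Lambda_i^s=\mathrm{diag}(\hat{\Lambda}_i^s,\overline{\hat{\Lambda}_i^s}),$$ $\hat{\Lambda}_i^s=\mathrm{diag}(J_1(\lambda_i^s),\dots,J_{m_i}(\lambda_i^s))$,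 $\Lambda_j^s=\mathrm{diag}(J_1(\lambda_j^s),\dots,J_{m_j}(\lambda_j^s))$, the $l$-th blocks having size $\#(X^c_{i,l})$, respectively $\#(X^c_{j,l})$. (i) The real matrices $\Delta A\in\mathbb{J}$ for which $\{(\lambda^a_i,X^c_{i,l})\}_{l=1}^{m_i}$, $\{(\overline{\lambda^a_i},\overline{X^c_{i,l}})\}_{l=1}^{m_i}$, $\{(\lambda^a_j,X^c_{j,l})\}_{l=1}^{m_j}$ (for all $i,j$) are Jordan pairs of $A+\Delta A$ are exactly those of the form $$\Delta A=X_c(\Lambda_a-\Lambda_c)X_c^{\dagger}+H^{-1}(X_c^\dagger)^*(\Lambda_a-\Lambda_c)^*X_c^*H-H^{-1}(X_c^{\dagger})^*X_c^*HX_c(\Lambda_a-\Lambda_c)X_c^{\dagger}+H^{-1}(I-X_cX_c^{\dagger})Z(I-X_cX_c^{\dagger}),$$ where $Z\in\mathbb{R}^{n\times n}$ with $Z=\epsilon_1Z^T$ is arbitrary. (ii) Let $q=\sum_{i=1}^r2\alpha(\lambda_i^c)+\sum_{j=2r+1}^p\alpha(\lambda_j^c)$ and let $\lambda_k^f$, $k=q+1,\dots,n$, be the remaining eigenvalues of $A$. If $\{\lambda_i^c,\overline{\lambda_i^c},\lambda_j^c:i=1,\dots,r,\ j=2r+1,\dots,p\}\cap\{\lambda_k^f:k=q+1,\dots,n\}=\emptyset$, then $$\Delta A=X_c(\Lambda_a-\Lambda_c)(X_c^*HX_c)^{-1}X_c^*H$$ is well defined and is a real structured no spillover perturbation: $\Delta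 A\in\mathbb{J}\subset\mathbb{R}^{n\times n}$, $(A+\Delta A)X_c=X_c\Lambda_a$, and $(A+\Delta A)X=XJ(\lambda_k^f)$ whenever $(\lambda_k^f,X)$ is a Jordan pair of $A$.
   Context: $H\in\mathbb{R}^{n\times n}$ is a fixed orthogonal matrix with $H^T=\epsilon_1H$, $\epsilon_1\in\{1,-1\}$, and $\mathbb{J}=\{A\in\mathbb{R}^{n\times n}:H^{-1}A^TH=A\}$. $*$ is the conjugate transpose, $T$ the transpose, $\overline{Z}$ the entrywise complex conjugate of $Z$, $X^\dagger$ the Moore-Penrose pseudoinverse, and $\alpha(\lambda)$ the algebraic multiplicity of the eigenvalue $\lambda$ of $A$. $J_l(\mu)$ denotes the upper triangular Jordan block with eigenvalue $\mu$ of the indicated size. A Jordan pair of $A$ is a pair $(\lambda,X)$ where $\lambda$ is a (possibly complex) eigenvalue of $A$ and the columns of $X$ are the (linearly independent) vectors of a Jordan chain for $\lambda$, ordered so that $AX=XJ(\lambda)$ with $J(\lambda)$ the Jordan block of size $\#(X)$, the number of columns of $X$. A complete collection $\{(\lambda,X_l)\}_{l=1}^m$ of Jordan pairs for an eigenvalue $\lambda$ of geometric multiplicity $m$ means that the columns of $X_1,\dots,X_m$ together form a basis of the generalized eigenspace of $\lambda$. *)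

(* Defs.v *)
From HB Require Import structures.
From mathcomp Require Import all_boot all_order all_algebra.
From mathcomp Require Import complex reals.
Set Implicit Arguments. Unset Strict Implicit. Unset Printing Implicit Defensive.
Import Order.TTheory GRing.Theory Num.Theory Num.Def.
Local Open Scope ring_scope.
Local Open Scope sesquilinear_scope.

Section MoorePenrose.
Variable C : numClosedFieldType.

(* The four Penrose equations; [pinvmx] of the library is only a one-sided
   inverse on the row space, not the Moore-Penrose inverse. *)
Definition is_mpinv m n (A : 'M[C]_(m, n)) (B : 'M[C]_(n, m)) : bool :=
  [&& A *m B *m A == A, B *m A *m B == B,
      (A *m B)^t* == A *m B & (B *m A)^t* == B *m A].

Lemma gram_unitmx m n (B : 'M[C]_(m, n)) :
  row_free B -> B *m B^t* \in unitmx.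
Proof.
move=> fB; rewrite -row_free_unit; apply: inj_row_free => v vBB.
have : dotmx (v *m B) (v *m B) = 0.
  by rewrite dotmxE trmx_mul map_mxM /= mulmxA -(mulmxA v) vBB mul0mx mxE.
by move/eqP; rewrite dnorm_eq0 => /eqP vB; apply: (row_free_inj fB); rewrite mul0mx.
Qed.

Lemma mpinv_exists m n (A : 'M[C]_(m, n)) : exists B, is_mpinv A B.
Proof.
have [r [L [B [-> fL fB]]]] : exists r (L : 'M[C]_(m, r)) (B : 'M[C]_(r, n)),
    [/\ A = L *m B, row_full L & row_free B].
  exists (\rank A), (col_base A), (row_base A).
  by rewrite mulmx_base col_base_full row_base_free.
have uB : B *m B^t* \in unitmx by apply: gram_unitmx.
have uL : L^t* *m L \in unitmx.
  have : L^t* *m (L^t*)^t* \in unitmx.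
    by apply: gram_unitmx; rewrite /row_free mxrank_map mxrank_tr.
  by rewrite trmxCK.
set GB := B *m B^t* in uB; set GL := L^t* *m L in uL.
pose P := B^t* *m invmx GB *m invmx GL *m L^t*.
have trinv k (G : 'M[C]_k) : G^t* = G -> (invmx G)^t* = invmx G.
  by move=> hG; rewrite trmx_inv map_invmx hG.
have hB : (invmx GB)^t* = invmx GB.
  by apply: trinv; rewrite /GB trmx_mul map_mxM /= trmxCK.
have hL : (invmx GL)^t* = invmx GL.
  by apply: trinv; rewrite /GL trmx_mul map_mxM /= trmxCK.
have AP : L *m B *m P = L *m invmx GL *m L^t*.
  by rewrite /P !mulmxA -(mulmxA L B) -/GB mulmxK.
have PA : P *m (L *m B) = B^t* *m invmx GB *m B.
  by rewrite /P !mulmxA -(mulmxA _ _ L) -/GL mulmxKV.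
exists P; rewrite /is_mpinv AP PA; apply/and4P; split; apply/eqP.
- by rewrite mulmxA -(mulmxA _ _ L) -/GL mulmxKV.
- by rewrite /P !mulmxA -(mulmxA _ B) -/GB mulmxKV.
- by rewrite !trmx_mul !map_mxM /= hL trmxCK mulmxA.
- by rewrite !trmx_mul !map_mxM /= hB trmxCK mulmxA.
Qed.

Lemma is_mpinv_uniq m n (A : 'M[C]_(m, n)) B B' :
  is_mpinv A B -> is_mpinv A B' -> B = B'.
Proof.
move=> /and4P[/eqP h1 /eqP h2 /eqP h3 /eqP h4].
move=> /and4P[/eqP k1 /eqP k2 /eqP k3 /eqP k4].
have e1 : A *m B = A *m B'.
  rewrite -h3 -{1}k1 -(mulmxA (A *m B')) trmx_mul map_mxM /= h3 k3.
  by rewrite mulmxA h1.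
have e2 : B *m A = B' *m A.
  rewrite -h4 -{1}k1 -(mulmxA A) mulmxA trmx_mul map_mxM /= h4 k4.
  by rewrite -mulmxA (mulmxA A) h1.
by rewrite -h2 e2 -mulmxA e1 mulmxA k2.
Qed.

Definition mpinv m n (A : 'M[C]_(m, n)) : 'M[C]_(n, m) :=
  xchoose (mpinv_exists A).

Lemma mpinvP m n (A : 'M[C]_(m, n)) : is_mpinv A (mpinv A).
Proof. exact: xchooseP. Qed.

End MoorePenrose.

Section Jordan.
Variable C : numClosedFieldType.

Definition jordan_block (k : nat) (lam : C) : 'M[C]_k :=
  \matrix_(i < k, j < k) (if i == j then lam
                          else if j == i.+1 :> nat then 1 else 0).

(* [eigenvalue], [eigenspace] and [geigenspace] of the library are about row
   vectors [v *m M]; applied to A^T they concern column vectors of A. *)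
Definition jordan_pair n k (A : 'M[C]_n) (lam : C) (X : 'M[C]_(n, k)) : Prop :=
  [/\ eigenvalue A^T lam, (0 < k)%N, row_free X^T
    & A *m X = X *m jordan_block k lam].

Definition complete_collection n m (A : 'M[C]_n) (lam : C)
    (k : 'I_m -> nat) (X : forall l, 'M[C]_(n, k l)) : Prop :=
  [/\ eigenvalue A^T lam, m = \rank (eigenspace A^T lam),
      forall l, jordan_pair A lam (X l), row_free (\mxrow_l X l)^T
    & ((\mxrow_l X l)^T == geigenspace A^T lam)%MS].

Definition alg_mult n (A : 'M[C]_n) (lam : C) : nat := mup lam (char_poly A).

Definition jordan_diag m (k : 'I_m -> nat) (lam : C) : 'M[C]_(\sum_l k l) :=
  \mxdiag_l jordan_block (k l) lam.

(* The nonreal eigenvalues are indexed by 'I_r and the real ones by 'I_t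
   (t = p - 2 r); [k i l] and [k' j l] are the lengths of the chains. *)
Section Assembly.
Variables (n r t : nat) (m : 'I_r -> nat) (m' : 'I_t -> nat).
Variables (k : forall i, 'I_(m i) -> nat) (k' : forall j, 'I_(m' j) -> nat).

Definition chain_total : nat :=
  (\sum_(i < r) (\sum_l @k i l + \sum_l @k i l) + \sum_(j < t) \sum_l @k' j l)%N.

Definition Xmat (X : forall i l, 'M[C]_(n, @k i l))
    (X' : forall j l, 'M[C]_(n, @k' j l)) : 'M[C]_(n, chain_total) :=
  row_mx (\mxrow_i row_mx (\mxrow_l X i l) (map_mx conjC (\mxrow_l X i l)))
         (\mxrow_j \mxrow_l X' j l).

Definition Lmat (lam : 'I_r -> C) (mu : 'I_t -> C) : 'M[C]_chain_total :=
  block_mx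
    (\mxdiag_i block_mx (jordan_diag (@k i) (lam i)) 0
                      0 (map_mx conjC (jordan_diag (@k i) (lam i))))
    0 0
    (\mxdiag_j jordan_diag (@k' j) (mu j)).

End Assembly.
End Jordan.

Arguments Xmat {C n r t m m' k k'}.
Arguments Lmat {C r t m m'} k k'.

Notation toC A := (map_mx (real_complex _) A).

(* Membership of A in the set J determined by H. *)
Definition structured (R : realType) n (H A : 'M[R]_n) : Prop :=
  invmx H *m A^T *m H = A.

(* Main.v *)
(* Since the pairs (lambda^c, lambda^a) come with their conjugates, the Chinese
   remainder theorem yields a real polynomial f congruent to lambda^a - lambda^c modulo
   (X - lambda^c)^n for every prescribed eigenvalue.  The real matrix F = f(A)
   inherits H F = F^T H and satisfies F X_c = X_c (Lambda_a - Lambda_c), so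
   X_c (Lambda_a - Lambda_c) can be replaced by F X_c in every formula, and
   reality and structure only have to be checked for the orthogonal projector
   X_c X_c^dagger in (i) and for the H-orthogonal projector
   X_c (X_c^* H X_c)^-1 X_c^* H in (ii).
   The columns of X_c form a basis of ker p(A), where p is the product of the
   (X - lambda^c)^n.  If q is the product of the X - lambda^f, then
   s p + w q = 1 for some s and w, and p q annihilates A; as p(A)
   is adjoint to p(A)^T through H, a vector of ker p(A) that is H-orthogonal to
   ker p(A) is H-orthogonal to everything, so X_c^* H X_c is invertible. *)
Require Import Defs.
From HB Require Import structures.
From mathcomp Require Import all_boot all_order all_algebra.
From mathcomp Require Import complex reals.
Set Implicit Arguments. Unset Strict Implicit. Unset Printing Implicit Defensive.
Import Order.TTheory GRing.Theory Num.Theory Num.Def.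
Local Open Scope ring_scope.
Local Open Scope complex_scope.
Local Open Scope sesquilinear_scope.

(** * Chinese remaindering and real interpolating polynomials *)

Lemma poly_chinese (K : fieldType) (T : finType) (p d : T -> {poly K}) :
  (forall x y, x != y -> coprimep (p x) (p y)) ->
  exists f, forall x, p x %| f - d x.
Proof.
move=> cop.
(* An idempotent of the Chinese remainder theorem: 1 modulo [p x] and 0 modulo every other [p y], so
   that [\sum_x d x * e x] solves all the congruences. *)
have cofactor x : exists e, (p x %| e - 1) /\ forall y, y != x -> p y %| e.
  have : coprimep (p x) (\prod_(y | y != x) p y).
    apply: (big_ind (fun q => coprimep (p x) q)) => [|q1 q2 c1 c2|y yx].
    - exact: coprimep1.
    - by rewrite coprimepMr c1 c2.
    - by apply: cop; rewrite eq_sym.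
  case/Bezout_eq1_coprimepP => -[u v] /= uv.
  exists (v * \prod_(y | y != x) p y); split.
    by rewrite -[X in _ - X]uv opprD addrCA subrr addr0 -mulNr dvdp_mull.
  by move=> y yx; rewrite (bigD1 y) //= mulrCA dvdp_mulr.
have [e he] := fin_all_exists cofactor.
exists (\sum_x d x * e x) => x; rewrite (bigD1 x) //= addrAC dvdp_addr.
  apply: (big_ind (fun q => p x %| q)) => [|q1 q2|y yx]; first exact: dvdp0.
    exact: dvdp_add.
  by rewrite dvdp_mull // (he y).2 // eq_sym.
by rewrite -{2}[d x]mulr1 -mulrBr dvdp_mull // (he x).1.
Qed.

Section ClosedField.
Variable C : numClosedFieldType.
Implicit Types (lam mu : C) (f p q : {poly C}).

Lemma map_poly_XsubC_expn n mu :
  map_poly conjC (('X - mu%:P) ^+ n) = ('X - (conjC mu)%:P) ^+ n.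
Proof. by rewrite rmorphXn rmorphB /= map_polyX map_polyC. Qed.

(** Nodes and values are stable under conjugation, so the coefficientwise conjugate of an
    interpolant is again one; the average of the two is real. *)
Lemma real_poly_interpolation n (T : finType) (lam del : T -> C) (bar : T -> T) :
  injective lam -> (forall x, lam (bar x) = conjC (lam x)) ->
  (forall x, del (bar x) = conjC (del x)) ->
  exists f, map_poly conjC f = f /\
    forall x, ('X - (lam x)%:P) ^+ n %| f - (del x)%:P.
Proof.
move=> lamI lamb delb.
have [|f hf] := @poly_chinese _ _ (fun x => ('X - (lam x)%:P) ^+ n)
    (fun x => (del x)%:P).
  move=> x y xy; rewrite coprimep_expr ?coprimep_expl // coprimep_XsubC root_XsubC.
  by rewrite (inj_eq lamI) eq_sym.
have barK x : bar (bar x) = x by apply: lamI; rewrite !lamb conjCK.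
have hfc x : ('X - (lam x)%:P) ^+ n %| map_poly conjC f - (del x)%:P.
  have := hf (bar x); rewrite -(dvdp_map (conjC : {rmorphism C -> C})) /=.
  by rewrite map_poly_XsubC_expn rmorphB /= map_polyC /= -lamb -delb barK.
have two_neq0 : (2 : C) != 0 by rewrite pnatr_eq0.
exists (2^-1 *: (f + map_poly conjC f)); split.
  rewrite map_polyZ rmorphD /= fmorphV rmorph_nat addrC; congr (_ *: (_ + _)).
  by apply/polyP => i; rewrite !coef_map /= conjCK.
move=> x; rewrite -(dvdpZr _ _ two_neq0) scalerBr scalerA mulfV // scale1r.
rewrite scaler_nat mulr2n opprD addrACA.
by rewrite dvdp_add.
Qed.

(** * Polynomials in a matrix that is selfadjoint with respect to [H] *)

Lemma horner_mx_trmx n (A : 'M[C]_n.+1) p : horner_mx A^T p = (horner_mx A p)^T.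
Proof.
elim/poly_ind: p => [|p c IH]; first by rewrite !rmorph0 trmx0.
rewrite !rmorphD !rmorphM /= !horner_mx_X !horner_mx_C IH linearD /= tr_scalar_mx.
by rewrite -mulmxE -trmx_mul (comm_horner_mx p (erefl : comm_mx A A)).
Qed.

Lemma horner_mx_selfadjoint n (H A : 'M[C]_n.+1) p :
  A^T *m H = H *m A -> (horner_mx A p)^T *m H = H *m horner_mx A p.
Proof.
move=> AH; elim/poly_ind: p => [|p c IH].
  by rewrite rmorph0 trmx0 mul0mx mulmx0.
rewrite rmorphD rmorphM /= horner_mx_X horner_mx_C linearD /= tr_scalar_mx.
rewrite mulmxDl mulmxDr scalar_mxC; congr (_ + _).
rewrite -mulmxE {1}(comm_horner_mx p (erefl : comm_mx A A)) trmx_mul.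
by rewrite -mulmxA AH !mulmxA IH.
Qed.

(** The multiple of [('X - mu%:P) ^+ n.+1] by which [f] differs from [d] kills the generalized
    eigenspace at [A]. The full power, rather than the linear factor, makes [f] act as a scalar on
    whole Jordan chains. *)
Lemma geigenspace_horner_mx n s (A : 'M[C]_n.+1) (Y : 'M_(n.+1, s)) mu d f :
  (Y^T <= geigenspace A^T mu)%MS -> ('X - mu%:P) ^+ n.+1 %| f - d%:P ->
  horner_mx A f *m Y = d *: Y.
Proof.
move=> /sub_kermxP; rewrite horner_mx_trmx -trmx_mul => /(canRL trmxK).
rewrite trmx0 => Y0 /dvdpP[g /(canRL (subrK _)) ->].
rewrite rmorphD rmorphM /= horner_mx_C mulmxDl -mulmxE -mulmxA Y0 mulmx0 add0r.
by rewrite mul_scalar_mx.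
Qed.

(* The matrix is [f(A)] for a real polynomial [f] congruent to [del x] modulo
   ['X - lam x] to the power [n]. *)
Lemma functional_calculus n (H A : 'M[C]_n) (T : finType) (lam del : T -> C)
    (bar : T -> T) :
  map_mx conjC A = A -> A^T *m H = H *m A ->
  injective lam -> (forall x, lam (bar x) = conjC (lam x)) ->
  (forall x, del (bar x) = conjC (del x)) ->
  exists F : 'M[C]_n, [/\ map_mx conjC F = F, F^T *m H = H *m F
    & forall x s (Y : 'M_(n, s)),
        (Y^T <= geigenspace A^T (lam x))%MS -> F *m Y = del x *: Y].
Proof.
case: n H A => [|n] H A cA AH lamI lamb delb.
  by exists 0; split=> [||x s Y _]; apply/matrixP => -[].
have [f [cf hf]] := real_poly_interpolation n.+1 lamI lamb delb.
exists (horner_mx A f); split.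
- by rewrite map_horner_mx /= cA cf.
- exact: horner_mx_selfadjoint.
- by move=> x s Y /geigenspace_horner_mx; apply.
Qed.

(* [Xc^T] rather than [Xc^*] pairs with [Xc] here, so that only [p], and not
   its conjugate, is involved. *)
Lemma row_free_gram n c (H A : 'M[C]_n) (Xc : 'M_(n, c)) (p q : {poly C}) :
  A^T *m H = H *m A -> row_free H -> row_free Xc^T ->
  (Xc^T :=: kermxpoly A^T p)%MS -> coprimep p q -> char_poly A %| p * q ->
  row_free (Xc^T *m H *m Xc).
Proof.
case: n H A Xc => [|n] H A Xc AH Hfree Xfree Xker.
  move: Xfree; rewrite /row_free thinmx0 mxrank0 => /eqP c0 _ _.
  by case: _ / c0 in Xc Xker *; rewrite -leqn0 rank_leq_row.
move=> /Bezout_eq1_coprimepP[[/= s w] sw] cpq.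
have AH' g : horner_mx A^T g *m H = H *m horner_mx A g.
  by rewrite horner_mx_trmx horner_mx_selfadjoint.
apply: inj_row_free => v vG; apply: (row_free_inj Xfree); rewrite mul0mx.
apply: (row_free_inj Hfree); rewrite mul0mx.
set u := v *m Xc^T.
have up : u *m horner_mx A^T p = 0.
  by apply/sub_kermxP; rewrite -Xker submxMl.
have uX : u *m H *m Xc = 0 by rewrite /u -!mulmxA mulmxA in vG *.
(* By Cayley-Hamilton [p * q] annihilates [A], so the columns of [(w * q)(A)] lie in the kernel of
   [p(A)], which is the span of [Xc]. *)
have wqker : ((horner_mx A (w * q))^T <= Xc^T)%MS.
  rewrite Xker; apply/sub_kermxP; rewrite -horner_mx_trmx mulmxE -rmorphM /=.
  rewrite -mulrA [q * p]mulrC horner_mx_trmx.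
  case/dvdpP: cpq => g ->; rewrite mulrA rmorphM /= Cayley_Hamilton.
  by rewrite mulr0 trmx0.
have A1 : horner_mx A (s * p + w * q) = 1%:M by rewrite sw rmorph1.
(* The [s * p] term vanishes because [p(A)] moves across [H] and kills [u]; the [w * q] term
   vanishes because it lands in the span of [Xc], to which [u *m H] is orthogonal. *)
rewrite -[u *m H]mulmx1 -A1 rmorphD /= mulmxDr.
rewrite -mulmxA -AH' mulrC rmorphM /= -mulmxE !mulmxA up !mul0mx add0r.
case/submxP: wqker => Z /(canRL trmxK) ->.
by rewrite trmx_mul trmxK mulmxA uX mul0mx.
Qed.

(** * Jordan chains under polynomials in [A], and their orthogonality *)

Lemma horner_mx_jordan n s (A : 'M[C]_n.+1) (Y : 'M_(n.+1, s)) mu :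
  A *m Y = Y *m jordan_block s mu -> horner_mx A (('X - mu%:P) ^+ s) *m Y = 0.
Proof.
case: s Y => [|s] Y AY; first by rewrite thinmx0.
(* Evaluation at [A] is carried over to evaluation at the Jordan block, where Cayley-Hamilton
   applies. *)
have HY f : horner_mx A f *m Y = Y *m horner_mx (jordan_block s.+1 mu) f.
  elim/poly_ind: f => [|f c IH]; first by rewrite !rmorph0 mulmx0 mul0mx.
  rewrite !rmorphD !rmorphM /= !horner_mx_X !horner_mx_C mulmxDl mulmxDr.
  rewrite -!mulmxE -mulmxA AY !mulmxA IH; congr (_ + _).
  by rewrite mul_scalar_mx mul_mx_scalar.
have <- : char_poly (jordan_block s.+1 mu) = ('X - mu%:P) ^+ s.+1.
  (* The block is upper triangular, while [char_poly_trig] expects a lower triangular matrix. *)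
  have -> : char_poly (jordan_block s.+1 mu) = char_poly (jordan_block s.+1 mu)^T.
    rewrite /char_poly -det_tr; congr (\det _); apply/matrixP => i j.
    by rewrite !mxE [j == i]eq_sym.
  rewrite char_poly_trig; last first.
    apply/is_trig_mxP => i j ij; rewrite !mxE.
    by rewrite -val_eqE /= (gtn_eqF ij) ltn_eqF // leqW.
  under eq_bigr do rewrite !mxE eqxx.
  by rewrite prodr_const card_ord.
by rewrite HY Cayley_Hamilton mulmx0.
Qed.

(** This is the source of no spillover: [('X - mu%:P) ^+ s] is coprime to [p], so a multiple of it
    acts as the identity on [U]; moved across [H], that multiple kills the chain [Y]. *)
Lemma jordan_chain_orthogonal n c s (H A : 'M[C]_n) (U : 'M_(c, n))
    (Y : 'M_(n, s)) (p : {poly C}) mu :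
  A^T *m H = H *m A -> (U <= kermxpoly A^T p)%MS -> ~~ root p mu ->
  A *m Y = Y *m jordan_block s mu -> U *m H *m Y = 0.
Proof.
case: n H A U Y => [|n] H A U Y AH; first by rewrite (flatmx0 Y) !mulmx0.
move=> /sub_kermxP Up; rewrite -coprimep_XsubC => /(coprimep_expr s).
move=> /Bezout_eq1_coprimepP[[/= g w] gw] /horner_mx_jordan Y0.
have A1 : horner_mx A^T (g * p + w * ('X - mu%:P) ^+ s) = 1%:M.
  by rewrite gw rmorph1.
have -> : U = U *m horner_mx A^T (w * ('X - mu%:P) ^+ s).
  rewrite -[LHS]mulmx1 -A1 rmorphD /= mulmxDr [g * p]mulrC rmorphM /= -mulmxE.
  by rewrite mulmxA Up mul0mx add0r.
rewrite -[U *m _ *m H]mulmxA horner_mx_trmx horner_mx_selfadjoint // rmorphM /=.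
by rewrite -mulmxE -!mulmxA Y0 !mulmx0.
Qed.

(** * Assembly of all chains into [Xmat] and [Lmat], and the space they span *)

Lemma map_mxrow_conj n m (k : 'I_m -> nat) (X : forall l, 'M[C]_(n, k l)) :
  map_mx conjC (\mxrow_l X l) = \mxrow_l map_mx conjC (X l).
Proof. by apply/matrixP => i j; rewrite !mxE. Qed.

Lemma map_mx_conjK m n (A : 'M[C]_(m, n)) : map_mx conjC (map_mx conjC A) = A.
Proof. by apply/matrixP => i j; rewrite !mxE conjCK. Qed.

Lemma jordan_block_conj s mu :
  map_mx conjC (jordan_block s mu) = jordan_block s (conjC mu).
Proof.
by apply/matrixP => i j; rewrite !mxE; case: eqP => // _; case: eqP => _;
  rewrite ?conjC1 ?conjC0.
Qed.

Lemma mulmx_jordan_diag n m (k : 'I_m -> nat) (M : 'M[C]_n)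
    (X : forall l, 'M[C]_(n, k l)) mu :
  M *m (\mxrow_l X l) = (\mxrow_l X l) *m jordan_diag k mu <->
  forall l, M *m X l = X l *m jordan_block (k l) mu.
Proof.
by rewrite mul_mxrow mul_mxrow_mxdiag; split=> [/eq_mxrowP | /eq_mxrowP].
Qed.

Section Chains.
Variables (n r t : nat) (m : 'I_r -> nat) (m' : 'I_t -> nat).
Variables (k : forall i : 'I_r, 'I_(m i) -> nat).
Variables (k' : forall j : 'I_t, 'I_(m' j) -> nat).
Variables (X : forall (i : 'I_r) (l : 'I_(m i)), 'M[C]_(n, k l)).
Variables (X' : forall (j : 'I_t) (l : 'I_(m' j)), 'M[C]_(n, k' l)).

(** [M] may be nonreal, so the equations for the conjugate chains are a separate clause; they reduce
    to [mulmx_jordan_diag] for the conjugate of [M]. *)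
Lemma mulmx_Xmat (M : 'M[C]_n) (lam : 'I_r -> C) (mu : 'I_t -> C) :
  M *m Xmat X X' = Xmat X X' *m Lmat k k' lam mu <->
  [/\ forall i l, M *m @X i l = @X i l *m jordan_block (k l) (lam i),
      forall i l, M *m map_mx conjC (@X i l)
                  = map_mx conjC (@X i l) *m jordan_block (k l) (conjC (lam i))
    & forall j l, M *m @X' j l = @X' j l *m jordan_block (k' l) (mu j)].
Proof.
have conj_chain i : M *m map_mx conjC (\mxrow_l @X i l) =
      map_mx conjC (\mxrow_l @X i l) *m map_mx conjC (jordan_diag (@k i) (lam i))
    <-> forall l, M *m map_mx conjC (@X i l)
                  = map_mx conjC (@X i l) *m jordan_block (k l) (conjC (lam i)).
  rewrite -map_mxM -(map_mx_conjK M) -map_mxM; split.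
    move=> /(can_inj (@map_mx_conjK _ _)) /mulmx_jordan_diag e l.
    by rewrite -jordan_block_conj -!map_mxM e.
  move=> e; congr (map_mx _ _); apply/mulmx_jordan_diag => l.
  by apply: (can_inj (@map_mx_conjK _ _)); rewrite !map_mxM jordan_block_conj.
rewrite /Xmat /Lmat mul_mx_row mul_row_block !mulmx0 addr0 add0r.
rewrite !mul_mxrow !mul_mxrow_mxdiag.
have pair_row i : M *m row_mx (\mxrow_l @X i l) (map_mx conjC (\mxrow_l @X i l)) =
    row_mx (M *m \mxrow_l @X i l) (M *m map_mx conjC (\mxrow_l @X i l)).
  exact: mul_mx_row.
split.
  move=> /eq_row_mx[/eq_mxrowP e /eq_mxrowP e'].
  have ee i : M *m (\mxrow_l @X i l) = (\mxrow_l @X i l) *m jordan_diag (@k i) (lam i)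
    /\ M *m map_mx conjC (\mxrow_l @X i l) = map_mx conjC (\mxrow_l @X i l) *m
       map_mx conjC (jordan_diag (@k i) (lam i)).
    have := e i; rewrite pair_row mul_row_block !mulmx0 addr0 add0r.
    by move=> /eq_row_mx.
  split=> [i | i | j].
  - by apply/mulmx_jordan_diag; case: (ee i).
  - by apply/conj_chain; case: (ee i).
  - by apply/mulmx_jordan_diag; apply: e'.
move=> [e1 e2 e3]; congr row_mx; last first.
  by apply: eq_mxrow => j; apply/mulmx_jordan_diag.
apply: eq_mxrow => i; rewrite pair_row mul_row_block !mulmx0 addr0 add0r.
by congr row_mx; [apply/mulmx_jordan_diag | apply/conj_chain].
Qed.

(** A single finite index type for all prescribed eigenvalues, the middle summand carrying the
    conjugates, lets interpolation and the decomposition into generalized eigenspaces treat them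
    uniformly. *)
Definition label (lam : 'I_r -> C) (mu : 'I_t -> C) (x : 'I_r + 'I_r + 'I_t) : C :=
  match x with
  | inl (inl i) => lam i
  | inl (inr i) => conjC (lam i)
  | inr j => mu j
  end.

Section Span.
Variables (B : 'M[C]_n) (lam : 'I_r -> C) (mu : 'I_t -> C).
Hypothesis label_inj : injective (label lam mu).
Hypothesis span1 : forall i, ((\mxrow_l @X i l)^T :=: geigenspace B (lam i))%MS.
Hypothesis span2 : forall i,
  ((map_mx conjC (\mxrow_l @X i l))^T :=: geigenspace B (conjC (lam i)))%MS.
Hypothesis span3 : forall j, ((\mxrow_l @X' j l)^T :=: geigenspace B (mu j))%MS.

Lemma Xmat_span_sum :
  ((Xmat X X')^T :=: \sum_x geigenspace B (label lam mu x))%MS.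
Proof.
rewrite !big_sumType /= -big_split /= /Xmat tr_row_mx !tr_mxrow.
apply: (eqmx_trans (eqmx_sym (addsmxE _ _))); apply: adds_eqmx.
  apply: (eqmx_trans (eqmx_col _)); apply: eqmx_sums => i _.
  apply: (eqmx_trans (genmxE _)); rewrite tr_row_mx.
  by apply: (eqmx_trans (eqmx_sym (addsmxE _ _))); apply: adds_eqmx.
apply: (eqmx_trans (eqmx_col _)); apply: eqmx_sums => j _.
exact: (eqmx_trans (genmxE _)).
Qed.

(** Kernels of pairwise coprime polynomials add up to the kernel of the product; the exponent [n] is
    the one in [geigenspace]. *)
Lemma Xmat_span :
  ((Xmat X X')^T :=: kermxpoly B (\prod_x ('X - (label lam mu x)%:P) ^+ n))%MS.
Proof.
apply: (eqmx_trans Xmat_span_sum); apply: eqmx_sym.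
apply: kermxpoly_prod => x y _ _ xy.
rewrite coprimep_expr ?coprimep_expl // coprimep_XsubC root_XsubC.
by rewrite (inj_eq label_inj).
Qed.

(** A rank count: the sum of generalized eigenspaces is direct, and their dimensions add up to the
    number of columns of [Xmat X X']. *)
Lemma Xmat_row_free :
  (forall i, row_free (\mxrow_l @X i l)^T) ->
  (forall j, row_free (\mxrow_l @X' j l)^T) -> row_free (Xmat X X')^T.
Proof.
move=> free1 free3; rewrite /row_free Xmat_span_sum.
have := mxdirect_sum_geigenspace B (P := predT) (in2W label_inj).
rewrite mxdirectE /= => /eqP ->; rewrite !big_sumType /= -big_split /=.
apply/eqP; congr (_ + _)%N; apply: eq_bigr => i _; last first.
  by rewrite -span3; apply/eqP/free3.
have /eqP free1i := free1 i.
by rewrite -span1 -span2 free1i mxrank_tr mxrank_map -mxrank_tr free1i.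
Qed.

End Span.
End Chains.

(** * Jordan pairs, products of linear factors, and reality of the orthogonal projector *)

Lemma mxrow_tr_sub n m (k : 'I_m -> nat) (X : forall l, 'M[C]_(n, k l)) l :
  ((X l)^T <= (\mxrow_l X l)^T)%MS.
Proof.
rewrite tr_mxrow (eqmx_col (fun i => (X i)^T)).
by rewrite (sumsmx_sup l) // genmxE.
Qed.

Lemma jordan_blockD s a b :
  jordan_block s (a + b) = jordan_block s a + b%:M :> 'M[C]_s.
Proof.
apply/matrixP => i j; rewrite !mxE; case: eqP => _; first by rewrite mulr1n.
by rewrite mulr0n addr0.
Qed.

Lemma add_intertwine n s (A D : 'M[C]_n) (Y : 'M_(n, s)) (L L' : 'M_s) :
  A *m Y = Y *m L -> (D *m Y = Y *m (L' - L) <-> (A + D) *m Y = Y *m L').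
Proof.
move=> AY; rewrite mulmxDl mulmxBr AY.
by split=> [-> | <-]; [rewrite addrC subrK | rewrite [Y *m L + _]addrC addrK].
Qed.

(** The eigenvalue condition comes for free: the first vector of the chain is a nonzero
    eigenvector. *)
Lemma jordan_pairI n s (M : 'M[C]_n) mu (Y : 'M[C]_(n, s)) :
  (0 < s)%N -> row_free Y^T -> M *m Y = Y *m jordan_block s mu ->
  jordan_pair M mu Y.
Proof.
case: s Y => // s Y _ Yfree MY; split=> //; apply/eigenvalueP.
have col0 : jordan_block s.+1 mu *m delta_mx ord0 (ord0 : 'I_1)
            = mu *: delta_mx ord0 ord0.
  rewrite -colE; apply/matrixP => i j; rewrite !mxE ord1 eqxx andbT.
  by case: eqP => _; rewrite ?mulr1 ?mulr0.
exists (delta_mx (ord0 : 'I_1) ord0 *m Y^T).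
  rewrite -mulmxA -trmx_mul MY trmx_mul mulmxA.
  rewrite -[delta_mx _ _]trmxK trmx_delta -trmx_mul col0 linearZ /=.
  by rewrite -scalemxAl.
apply/eqP => /(congr1 (mulmx^~ (pinvmx Y^T))).
rewrite mulmxKp // mul0mx => /matrixP/(_ ord0 ord0)/eqP.
by rewrite !mxE eqxx oner_eq0.
Qed.

Lemma map_poly_prod_XsubC n (T : finType) (lam : T -> C) (bar : T -> T) :
  injective lam -> (forall x, lam (bar x) = conjC (lam x)) ->
  map_poly conjC (\prod_x ('X - (lam x)%:P) ^+ n) = \prod_x ('X - (lam x)%:P) ^+ n.
Proof.
move=> lamI lamb; have barK : involutive bar.
  by move=> x; apply: lamI; rewrite !lamb conjCK.
rewrite rmorph_prod /= [RHS](reindex_inj (inv_inj barK)).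
by apply: eq_bigr => x _; rewrite map_poly_XsubC_expn lamb.
Qed.

Lemma nroot_prod_XsubC_exp n (T : finType) (lam : T -> C) a :
  (forall x, lam x != a) -> ~~ root (\prod_x ('X - (lam x)%:P) ^+ n) a.
Proof.
move=> lama; rewrite /root horner_prod prodf_seq_neq0; apply/allP => x _ /=.
by rewrite horner_exp hornerXsubC expf_neq0 // subr_eq0 eq_sym.
Qed.

Lemma dvdp_prod (T : finType) (p q : T -> {poly C}) :
  (forall x, p x %| q x) -> \prod_x p x %| \prod_x q x.
Proof.
move=> pq; apply: (big_ind2 (fun a b => a %| b)) => // a b a' b'.
exact: dvdp_mul.
Qed.

(** This lets the uniform exponent [n] absorb every algebraic multiplicity. *)
Lemma alg_mult_le n (M : 'M[C]_n) a : (alg_mult M a <= n)%N.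
Proof.
have M0 : char_poly M != 0 by rewrite monic_neq0 // char_poly_monic.
rewrite -ltnS -(size_char_poly M) -(size_exp_XsubC _ a).
by rewrite dvdp_leq // -mup_geq.
Qed.

(** Write [P] for the projector. As conjugation preserves the span of [Xc], [P] fixes the columns of
    its conjugate [P'], so [P *m P' = P']. Since [P^T = P'], transposing gives [P *m P' = P]. *)
Lemma mulmx_mpinv_conj n c (Xc : 'M[C]_(n, c)) :
  ((map_mx conjC Xc)^T <= Xc^T)%MS ->
  map_mx conjC (Xc *m mpinv Xc) = Xc *m mpinv Xc.
Proof.
have /and4P[/eqP XdX _ /eqP Padj _] := mpinvP Xc.
case/submxP => Z /(canRL trmxK); rewrite trmx_mul trmxK => cX.
set P := Xc *m mpinv Xc in XdX Padj *.
have PcP : P *m map_mx conjC P = map_mx conjC P.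
  by rewrite {2 3}/P map_mxM cX !mulmxA XdX.
have PT : P^T = map_mx conjC P by rewrite -[in RHS]Padj map_mx_conjK.
by have := congr1 trmx PcP; rewrite trmx_mul -!PT trmxK PT PcP.
Qed.

(** * Structured perturbations expressed through the orthogonal projector [P] *)

Section Algebra.
Variables (n c : nat) (H : 'M[C]_n) (eps : C) (Xc : 'M[C]_(n, c)).
Hypotheses (Horth : H^T *m H = 1%:M) (Hreal : map_mx conjC H = H).
Hypotheses (eps2 : eps * eps = 1) (Hsym : H^T = eps *: H).
Variables (Xd : 'M[C]_(c, n)) (P : 'M[C]_n).
Hypotheses (PE : Xc *m Xd = P) (PXc : P *m Xc = Xc).
Hypotheses (Preal : map_mx conjC P = P) (Ptr : P^T = P).

Let Hunit : H \in unitmx.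
Proof. by case/mulmx1_unit: Horth. Qed.

Let eq_on_H m (M N : 'M[C]_(n, m)) : H *m M = H *m N -> M = N.
Proof. by move/(congr1 (mulmx (invmx H))); rewrite !mulKmx. Qed.

(** Structure of [D] becomes symmetry of [H *m D] up to the sign [eps], the same symmetry as that of
    the parameter [Z]. *)
Lemma selfadjoint_symE (D : 'M[C]_n) :
  D^T *m H = H *m D <-> (H *m D)^T = eps *: (H *m D).
Proof.
rewrite trmx_mul Hsym -scalemxAr; split=> [-> // | ].
by move/(congr1 ( *:%R eps)); rewrite !scalerA eps2 !scale1r.
Qed.

(** Trades the complex data [Xc], [E], [Xd] for the real matrices [W] and [P]. It serves with [W]
    the perturbation itself for necessity, and with [W] the interpolating matrix for sufficiency. *)
Lemma perturbation_formulaE (W : 'M[C]_n) (E : 'M[C]_c) :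
  map_mx conjC W = W -> W *m Xc = Xc *m E ->
  Xc *m E *m Xd + invmx H *m Xd^t* *m E^t* *m Xc^t* *m H
   - invmx H *m Xd^t* *m Xc^t* *m H *m Xc *m E *m Xd
  = W *m P + invmx H *m (P *m W^T *m H) - invmx H *m (P *m H *m W *m P).
Proof.
move=> Wreal WX.
have WP : Xc *m E *m Xd = W *m P by rewrite -WX -mulmxA PE.
have WPadj : Xd^t* *m E^t* *m Xc^t* = P *m W^T.
  rewrite -[RHS]map_mx_conjK [in RHS]map_mxM -[in RHS]map_trmx Preal Wreal.
  rewrite -{1}Ptr -trmx_mul.
  by rewrite -WP !trmx_mul !map_mxM !mulmxA.
have PXd : Xd^t* *m Xc^t* = P.
    by rewrite -map_mxM -trmx_mul PE Ptr Preal.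
by rewrite -[P *m H *m W *m P]mulmxA -WP -WPadj -PXd !mulmxA.
Qed.

(** The free parameter is [H *m D]: inserting [1 = P + (1 - P)] on both sides of [H *m D] produces
    exactly the terms of the formula. *)
Lemma structured_perturbation_necessary (D : 'M[C]_n) (E : 'M[C]_c) :
  map_mx conjC D = D -> D^T *m H = H *m D -> D *m Xc = Xc *m E ->
  D = Xc *m E *m Xd + invmx H *m Xd^t* *m E^t* *m Xc^t* *m H
      - invmx H *m Xd^t* *m Xc^t* *m H *m Xc *m E *m Xd
      + invmx H *m (1%:M - P) *m (H *m D) *m (1%:M - P).
Proof.
move=> Dreal DH DX; rewrite (perturbation_formulaE Dreal DX).
apply: eq_on_H; rewrite mulmxDr mulmxBr mulmxDr -!mulmxA !mulKVmx // DH.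
rewrite !mulmxBl !mulmxBr !mul1mx !mulmx1 !mulmxA.
by rewrite -[X in _ = _ + X]addrA -opprD [H *m D *m P + (_ - _)]addrA [RHS]addrC subrK.
Qed.

(** All three claims are checked on [H *m D]. Under transposition its first two terms swap up to
    [eps]; on [Xc] the second and third cancel and [1 - P] vanishes. *)
Lemma structured_perturbation_sufficient (F Z : 'M[C]_n) (E : 'M[C]_c) :
  map_mx conjC F = F -> F^T *m H = H *m F -> F *m Xc = Xc *m E ->
  map_mx conjC Z = Z -> Z = eps *: Z^T ->
  let D := Xc *m E *m Xd + invmx H *m Xd^t* *m E^t* *m Xc^t* *m H
      - invmx H *m Xd^t* *m Xc^t* *m H *m Xc *m E *m Xd
      + invmx H *m (1%:M - P) *m Z *m (1%:M - P) in
  [/\ map_mx conjC D = D, D^T *m H = H *m D & D *m Xc = Xc *m E].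
Proof.
move=> Freal FH FX Zreal Zsym D.
have HD : H *m D = H *m F *m P + P *m H *m F - P *m H *m F *m P
                   + (1%:M - P) *m Z *m (1%:M - P).
  rewrite /D (perturbation_formulaE Freal FX); move: (1%:M - P) => N.
  by rewrite !mulmxDr mulmxN -!mulmxA !mulKVmx // FH.
clearbody D.
split.
- apply: eq_on_H; rewrite -{1}Hreal -map_mxM HD.
  rewrite !(map_mxD, map_mxB, map_mxM, map_mxN) /= map_mx1.
  by rewrite Preal Hreal Freal Zreal.
- have NT : (1%:M - P)^T = 1%:M - P by rewrite linearB /= trmx1 Ptr.
  have ZT : Z^T = eps *: Z by rewrite {2}Zsym scalerA eps2 scale1r.
  apply/selfadjoint_symE; rewrite HD; move: (1%:M - P) NT => N NT.
  have trD (M1 M2 : 'M[C]_n) : (M1 + M2)^T = M1^T + M2^T by exact: linearD.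
  have trN (M1 : 'M[C]_n) : (- M1)^T = - M1^T by exact: linearN.
  rewrite !(trD, trN, scalerDr, scalerN) !trmx_mul NT Ptr ZT Hsym.
  rewrite -!(scalemxAl, scalemxAr) [F^T *m (H *m P)]mulmxA !FH !mulmxA.
  by rewrite [eps *: (P *m H *m F) + _]addrC.
- have NX : (1%:M - P) *m Xc = 0 by rewrite mulmxBl mul1mx PXc subrr.
  apply: eq_on_H; rewrite mulmxA HD; move: (1%:M - P) NX => N NX.
  rewrite !mulmxDl mulNmx -!mulmxA PXc NX FX !mulmx0 addr0.
  by rewrite addrK.
Qed.

(** With [Q'] the conjugate of [Q], conjugating the hypotheses gives [Q *m Q' = Q'] and
    [H *m Q' = Q^T *m H]. Hence [H *m Q' = Q^t* *m H *m Q' = (Q *m Q')^T *m H = Q^t* *m H = H *m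
    Q]. *)
Lemma selfadjoint_projection_real (Q : 'M[C]_n) :
  map_mx conjC Q *m Q = Q -> H *m Q = Q^t* *m H -> map_mx conjC Q = Q.
Proof.
move=> cQQ HQ.
have QcQ : Q *m map_mx conjC Q = map_mx conjC Q.
  by rewrite -[in RHS]cQQ [RHS]map_mxM map_mx_conjK.
apply: eq_on_H; rewrite -QcQ mulmxA HQ -mulmxA.
have -> : H *m map_mx conjC Q = Q^T *m H.
  by rewrite -{1}Hreal -map_mxM HQ map_mxM Hreal map_mx_conjK.
rewrite -[in RHS]cQQ trmx_mul map_mxM.
by rewrite [(map_mx conjC Q)^T]map_trmx map_mx_conjK mulmxA.
Qed.

(** * The [H]-orthogonal projector [Q] onto the span of [Xc] *)

Section NoSpillover.
Hypothesis Xfree : row_free Xc^T.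
Hypothesis Xreal : ((map_mx conjC Xc)^T <= Xc^T)%MS.
Local Notation G := (Xc^t* *m H *m Xc).

(** Stability of the span under conjugation gives [Xc^t* = W *m Xc^T], which carries nondegeneracy
    from the bilinear Gram matrix to the sesquilinear one. *)
Lemma hermitian_gram_unitmx : row_free (Xc^T *m H *m Xc) -> G \in unitmx.
Proof.
move=> Gfree; rewrite -row_free_unit; apply: inj_row_free => v.
have XCfree : row_free (Xc^t*) by rewrite /row_free mxrank_map.
have [W cX] : exists W, Xc^t* = W *m Xc^T.
  by case/submxP: Xreal => W e; exists W; rewrite -map_trmx.
rewrite cX -!mulmxA => vG; apply: (row_free_inj XCfree); rewrite mul0mx cX.
have vW : v *m W = 0 by apply: (row_free_inj Gfree); rewrite mul0mx -vG !mulmxA.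
by rewrite mulmxA vW mul0mx.
Qed.

Hypothesis Gunit : G \in unitmx.
Let Q := Xc *m invmx G *m Xc^t* *m H.

Let QXc : Q *m Xc = Xc.
Proof. by rewrite /Q -!mulmxA [Xc^t* *m _]mulmxA mulVmx // mulmx1. Qed.

Let HQ : H *m Q = Q^t* *m H.
Proof.
have HH : H^t* = eps *: H by rewrite -map_trmx Hreal.
have GG : G^t* = eps *: G.
  by rewrite !trmx_mul !map_mxM trmxCK HH -scalemxAl -scalemxAr mulmxA.
rewrite /Q !trmx_mul !map_mxM trmxCK HH trmx_inv map_invmx GG.
have eps_unit : eps \is a GRing.unit.
  by apply/unitrP; exists eps.
rewrite invmxZ ?unitmxZ // (mulr1_eq eps2).
by rewrite -!(scalemxAl, scalemxAr) scalerA eps2 scale1r !mulmxA.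
Qed.

Let Qreal : map_mx conjC Q = Q.
Proof.
have [W cX] : exists W, map_mx conjC Xc = Xc *m W.
  by case/submxP: Xreal => W /(canRL trmxK); rewrite trmx_mul trmxK; exists W^T.
(* [Q] fixes the conjugate of [Xc], whose columns lie in the span of [Xc]; conjugating, the
   conjugate of [Q] fixes [Xc]. *)
have cQX : map_mx conjC Q *m Xc = Xc.
  rewrite -[X in _ *m X]map_mx_conjK cX -map_mxM mulmxA QXc.
  by rewrite -cX map_mx_conjK.
by apply: selfadjoint_projection_real; rewrite ?HQ // {2}/Q !mulmxA cQX.
Qed.

(** [D] equals both [F *m Q] and [Q *m F], the latter because [E] is selfadjoint for [G]. Structure
    and reality then follow from those of [F] and [Q]. *)
Lemma no_spillover_perturbation (F : 'M[C]_n) (E : 'M[C]_c) :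
  map_mx conjC F = F -> F^T *m H = H *m F -> F *m Xc = Xc *m E ->
  let D := Xc *m E *m invmx G *m Xc^t* *m H in
  [/\ map_mx conjC D = D, D^T *m H = H *m D & D *m Xc = Xc *m E].
Proof.
move=> Freal FH FX D.
have DE : D = F *m Q by rewrite /D /Q -FX !mulmxA.
have XF : Xc^t* *m F^T = E^t* *m Xc^t*.
  by rewrite -map_mxM -trmx_mul -FX trmx_mul map_mxM -[F^t*]map_trmx Freal.
have GE : G *m E = E^t* *m G.
  by rewrite -mulmxA -FX mulmxA -[_ *m H *m F]mulmxA -FH mulmxA XF -!mulmxA.
have EG : E *m invmx G = invmx G *m E^t*.
  rewrite -[LHS](mulKmx Gunit) [G *m (E *m _)]mulmxA GE.
  by rewrite -[E^t* *m G *m _]mulmxA mulmxV // mulmx1.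
have DE' : D = Q *m F.
  rewrite /Q -[_ *m H *m F]mulmxA -FH mulmxA -[_ *m Xc^t* *m F^T]mulmxA XF.
  by rewrite mulmxA -[Xc *m invmx G *m _]mulmxA -EG !mulmxA.
split.
- by rewrite DE map_mxM Freal Qreal.
- rewrite {1}DE trmx_mul -mulmxA FH mulmxA.
  have -> : Q^T = Q^t* by rewrite -map_trmx Qreal.
  by rewrite -HQ -mulmxA -DE'.
- by rewrite DE -mulmxA QXc FX.
Qed.

End NoSpillover.
End Algebra.
End ClosedField.

(** * Passage between real matrices and complex matrices fixed by conjugation *)

Section RealMatrices.
Variable R : realType.

Lemma conj_toC m n (M : 'M[R]_(m, n)) : map_mx conjC (toC M) = toC M.
Proof. by apply/matrixP => i j; rewrite !mxE conj_Creal // complex_real. Qed.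

Lemma real_mxP m n (M : 'M[R[i]]_(m, n)) :
  map_mx conjC M = M -> exists M0 : 'M[R]_(m, n), M = toC M0.
Proof.
move=> /matrixP cM; exists (map_mx (@complex.Re R) M).
apply/matrixP => i j; rewrite !mxE RRe_real //; apply/CrealP.
by have := cM i j; rewrite mxE.
Qed.

Lemma toC_inj m n : injective (fun M : 'M[R]_(m, n) => toC M).
Proof.
by move=> M N /matrixP MN; apply/matrixP => i j; have := MN i j; rewrite !mxE => -[].
Qed.

Lemma structuredE n (H D : 'M[R]_n) : H^T *m H = 1%:M ->
  structured H D <-> (toC D)^T *m toC H = toC H *m toC D.
Proof.
move=> /mulmx1_unit[_ Hunit]; rewrite map_trmx -!map_mxM; split.
  by rewrite /structured => {2}<-; rewrite !mulmxA mulmxV // mul1mx.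
by move/toC_inj => DH; rewrite /structured -mulmxA DH mulKmx.
Qed.

End RealMatrices.

(** * Both characterizations deduced from the interpolating matrix [F] *)

Theorem theorem3p9 (R : realType) (n : nat) (H : 'M[R]_n) (eps1 : R)
  (Horth : H^T *m H = 1%:M)
  (Heps : eps1 = 1 \/ eps1 = -1)
  (Hsym : H^T = eps1 *: H)
  (A : 'M[R]_n) (AJ : structured H A)
  (r t : nat) (m : 'I_r -> nat) (m' : 'I_t -> nat)
  (k : forall i : 'I_r, 'I_(m i) -> nat)
  (k' : forall j : 'I_t, 'I_(m' j) -> nat)
  (lamc : 'I_r -> R[i]) (muc : 'I_t -> R)
  (X : forall (i : 'I_r) (l : 'I_(m i)), 'M[R[i]]_(n, k i l))
  (X' : forall (j : 'I_t) (l : 'I_(m' j)), 'M[R[i]]_(n, k' j l))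
  (lamc_nonreal : forall i, lamc i \isn't Num.real)
  (collc : forall i, complete_collection (toC A) (lamc i) (X i))
  (collc_conj : forall i, complete_collection (toC A) (conjC (lamc i))
                            (fun l => map_mx conjC (X i l)))
  (collr : forall j, complete_collection (toC A) (muc j)%:C (X' j))
  (lamc_inj : injective lamc) (muc_inj : injective muc)
  (lamc_conj : forall i i', lamc i != conjC (lamc i'))
  (lamc_muc : forall i j, lamc i != (muc j)%:C /\ conjC (lamc i) != (muc j)%:C)
  (lama : 'I_r -> R[i]) (mua : 'I_t -> R)
  (lama_nonreal : forall i, lama i \isn't Num.real) :
  let AC : 'M[R[i]]_n := toC A in
  let HC : 'M[R[i]]_n := toC H in
  let Xc := Xmat X X' in
  let Xd := mpinv Xc in
  let Lc := Lmat k k' lamc (fun j => (muc j)%:C) in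
  let La := Lmat k k' lama (fun j => (mua j)%:C) in
  (* (i) *)
  (forall D : 'M[R[i]]_n,
    (exists DA : 'M[R]_n,
      [/\ D = toC DA, structured H DA,
          forall i l, jordan_pair (AC + D) (lama i) (X i l),
          forall i l, jordan_pair (AC + D) (conjC (lama i)) (map_mx conjC (X i l))
        & forall j l, jordan_pair (AC + D) (mua j)%:C (X' j l)])
    <->
    (exists Z : 'M[R]_n,
      Z = eps1 *: Z^T /\
      D = Xc *m (La - Lc) *m Xd
          + invmx HC *m Xd^t* *m (La - Lc)^t* *m Xc^t* *m HC
          - invmx HC *m Xd^t* *m Xc^t* *m HC *m Xc *m (La - Lc) *m Xd
          + invmx HC *m (1%:M - Xc *m Xd) *m toC Z *m (1%:M - Xc *m Xd)))
  /\
  (* (ii) *)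
  (let q := (\sum_(i < r) 2 * alg_mult AC (lamc i)
             + \sum_(j < t) alg_mult AC (muc j)%:C)%N in
   forall lamf : 'I_(n - q) -> R[i],
     (* the [lamf x], with multiplicity, are the remaining eigenvalues of A *)
     char_poly AC =
       \prod_(i < r) (('X - (lamc i)%:P) ^+ alg_mult AC (lamc i)
                      * ('X - (conjC (lamc i))%:P) ^+ alg_mult AC (lamc i))
       * \prod_(j < t) ('X - ((muc j)%:C)%:P) ^+ alg_mult AC (muc j)%:C
       * \prod_(x < n - q) ('X - (lamf x)%:P) ->
     (forall x, [/\ forall i, lamc i != lamf x,
                    forall i, conjC (lamc i) != lamf x
                  & forall j, (muc j)%:C != lamf x]) ->
     Xc^t* *m HC *m Xc \in unitmx /\
     exists DA : 'M[R]_n,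
       [/\ toC DA = Xc *m (La - Lc) *m invmx (Xc^t* *m HC *m Xc) *m Xc^t* *m HC,
           structured H DA,
           (AC + toC DA) *m Xc = Xc *m La
         & forall (x : 'I_(n - q)) (s : nat) (Y : 'M[R[i]]_(n, s)),
             jordan_pair AC (lamf x) Y ->
             (AC + toC DA) *m Y = Y *m jordan_block s (lamf x)]).
Proof.
move=> AC HC Xc Xd Lc La.
pose mucC j := (muc j)%:C; pose muaC j := (mua j)%:C.
have conj_real (x : R) : conjC (x%:C) = x%:C by rewrite conj_Creal // complex_real.
have ACreal : map_mx conjC AC = AC by apply: conj_toC.
have HCreal : map_mx conjC HC = HC by apply: conj_toC.
have HCorth : HC^T *m HC = 1%:M by rewrite map_trmx -map_mxM Horth map_mx1.
have HCunit : HC \in unitmx by case/mulmx1_unit: HCorth.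
have AH : AC^T *m HC = HC *m AC by apply/structuredE.
pose eps : R[i] := eps1%:C.
have eps2 : eps * eps = 1.
  by rewrite -rmorphM; case: Heps => ->; rewrite ?mulrNN mulr1 rmorph1.
have HCsym : HC^T = eps *: HC by rewrite map_trmx Hsym map_mxZ.
pose bar (x : 'I_r + 'I_r + 'I_t) : 'I_r + 'I_r + 'I_t :=
  match x with
  | inl (inl i) => inl (inr i) | inl (inr i) => inl (inl i) | inr j => inr j
  end.
pose lam := label lamc mucC.
pose del := label (fun i => lama i - lamc i) (fun j => muaC j - mucC j).
have lam_bar x : lam (bar x) = conjC (lam x).
  by case: x => [[i|i]|j] //=; rewrite ?conjCK ?conj_real.
have del_bar x : del (bar x) = conjC (del x).
  by case: x => [[i|i]|j] //=; rewrite ?conjCK // rmorphB /= !conj_real.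
have lam_inj : injective lam.
  move=> [[i|i]|j] [[i'|i']|j'] //= e.
  - by rewrite (lamc_inj _ _ e).
  - by move/eqP: e; rewrite (negPf (lamc_conj _ _)).
  - by move/eqP: e; rewrite (negPf (lamc_muc _ _).1).
  - by move/esym/eqP: e; rewrite (negPf (lamc_conj _ _)).
  - by rewrite (lamc_inj _ _ (can_inj (@conjCK _) e)).
  - by move/eqP: e; rewrite (negPf (lamc_muc _ _).2).
  - by move/esym/eqP: e; rewrite (negPf (lamc_muc _ _).1).
  - by move/esym/eqP: e; rewrite (negPf (lamc_muc _ _).2).
  - by move/complexI: e => /muc_inj ->.
have span1 i : ((\mxrow_l X i l)^T :=: geigenspace AC^T (lamc i))%MS.
  by apply/eqmxP; case: (collc i).
have span2 i :
    ((map_mx conjC (\mxrow_l X i l))^T :=: geigenspace AC^T (conjC (lamc i)))%MS.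
  by apply/eqmxP; rewrite map_mxrow_conj; case: (collc_conj i).
have span3 j : ((\mxrow_l X' j l)^T :=: geigenspace AC^T (mucC j))%MS.
  by apply/eqmxP; case: (collr j).
have Xfree : row_free Xc^T.
  apply: (Xmat_row_free lam_inj span1 span2 span3) => [i | j].
    by case: (collc i).
  by case: (collr j).
pose p := \prod_x ('X - (lam x)%:P) ^+ n.
have Xker : (Xc^T :=: kermxpoly AC^T p)%MS := Xmat_span lam_inj span1 span2 span3.
(* The span of [Xc] is the kernel of [p(A)] with [p] and [A] real. *)
have Xreal : ((map_mx conjC Xc)^T <= Xc^T)%MS.
  have pc : map_poly conjC p = p by apply: map_poly_prod_XsubC lam_bar.
  have kerc : map_mx conjC (kermxpoly AC^T p) = kermxpoly AC^T p.
    by rewrite map_kermxpoly /= pc -map_trmx ACreal.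
  by rewrite map_trmx Xker -kerc map_submx Xker.
have [F [Freal FH FY]] := functional_calculus ACreal AH lam_inj lam_bar del_bar.
have chains M : M *m Xc = Xc *m La <->
    [/\ forall i l, M *m X i l = X i l *m jordan_block (k i l) (lama i),
        forall i l, M *m map_mx conjC (X i l)
                    = map_mx conjC (X i l) *m jordan_block (k i l) (conjC (lama i))
      & forall j l, M *m X' j l = X' j l *m jordan_block (k' j l) (muaC j)].
  exact: mulmx_Xmat.
have AX : AC *m Xc = Xc *m Lc.
  apply/mulmx_Xmat; split=> [i l | i l | j l].
  - by have [_ _ /(_ l)[_ _ _ ->]] := collc i.
  - by have [_ _ /(_ l)[_ _ _ ->]] := collc_conj i.
  - by have [_ _ /(_ l)[_ _ _ ->]] := collr j.
(* Acting as the scalar [b - a] on a chain, [F] only moves the diagonal of its Jordan block. *)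
have shift s (Y : 'M_(n, s)) a b : AC *m Y = Y *m jordan_block s a ->
    F *m Y = (b - a) *: Y -> (AC + F) *m Y = Y *m jordan_block s b.
  move=> AY FY'; rewrite mulmxDl AY FY' -mul_mx_scalar -mulmxDr -jordan_blockD.
  by rewrite [a + _]addrC subrK.
have XL D : D *m Xc = Xc *m (La - Lc) <-> (AC + D) *m Xc = Xc *m La.
  exact: add_intertwine.
have FX : F *m Xc = Xc *m (La - Lc).
  apply/XL/chains; split=> [i l | i l | j l].
  - apply: (shift _ _ (lamc i)); first by have [_ _ /(_ l)[_ _ _ ->]] := collc i.
    apply: (FY (inl (inl i))); rewrite /= -span1; exact: mxrow_tr_sub.
  - apply: (shift _ _ (conjC (lamc i))).
      by have [_ _ /(_ l)[_ _ _ ->]] := collc_conj i.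
    rewrite -rmorphB; apply: (FY (inl (inr i))); rewrite /= -span2 map_mxrow_conj.
    exact: (mxrow_tr_sub (fun l => map_mx conjC (X i l))).
  - apply: (shift _ _ (mucC j)); first by have [_ _ /(_ l)[_ _ _ ->]] := collr j.
    apply: (FY (inr j)); rewrite /= -span3; exact: mxrow_tr_sub.
pose P := Xc *m Xd.
have PXc : P *m Xc = Xc by have /and4P[/eqP] := mpinvP Xc.
have Preal : map_mx conjC P = P by apply: mulmx_mpinv_conj.
have Ptr : P^T = P.
  by have /and4P[_ _ /eqP e _] := mpinvP Xc; rewrite -[LHS]map_mx_conjK e.
split.
  move=> D; split.
    case=> DA [DE DJ c1 c2 c3].
    have DX : D *m Xc = Xc *m (La - Lc).
      apply/XL/chains; split=> [i l | i l | j l].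
      - by case: (c1 i l).
      - by case: (c2 i l).
      - by case: (c3 j l).
    have DH : D^T *m HC = HC *m D by rewrite DE; apply/structuredE.
    (* Multiplication by [H] turns the structured [DA] into an admissible [Z]. *)
    exists (H *m DA); split.
      apply: toC_inj; rewrite map_mxZ -map_trmx map_mxM -DE.
      have /(selfadjoint_symE eps2 HCsym) -> := DH.
      by rewrite scalerA eps2 scale1r.
    rewrite map_mxM -DE; apply: structured_perturbation_necessary => //.
    by rewrite DE conj_toC.
  case=> Z [Zsym DE].
  have [Dreal DH DX] : [/\ map_mx conjC D = D, D^T *m HC = HC *m D
      & D *m Xc = Xc *m (La - Lc)].
    rewrite DE; apply: (structured_perturbation_sufficient HCorth HCreal eps2 HCsym
      (erefl P) PXc Preal Ptr Freal FH FX); first exact: conj_toC.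
    by rewrite {1}Zsym map_mxZ map_trmx.
  have [DA DAE] := real_mxP Dreal.
  have /XL/chains[c1 c2 c3] := DX.
  exists DA; split=> //.
  - by apply/structuredE; rewrite -?DAE.
  - move=> i l; have [_ _ /(_ l)[_ s0 Yfree _] _ _] := collc i.
    exact: jordan_pairI.
  - move=> i l; have [_ _ /(_ l)[_ s0 Yfree _] _ _] := collc_conj i.
    exact: jordan_pairI.
  - move=> j l; have [_ _ /(_ l)[_ s0 Yfree _] _ _] := collr j.
    exact: jordan_pairI.
move=> q lamf charE lamf_neq.
have lam_neq x y : lam y != lamf x.
  have [n1 n2 n3] := lamf_neq x.
  by case: y => [[i|i]|j]; [exact: n1 | exact: n2 | exact: n3].
have root_p x : ~~ root p (lamf x) := nroot_prod_XsubC_exp n (lam_neq x).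
pose pf := \prod_(x < n - q) ('X - (lamf x)%:P).
have cop_p : coprimep p pf.
  apply: (big_ind (fun f => coprimep p f)) => [|f g cf cg|x _].
  - exact: coprimep1.
  - by rewrite coprimepMr cf cg.
  - by rewrite coprimep_XsubC root_p.
have dvd_p : char_poly AC %| p * pf.
  rewrite charE dvdp_mul // /p !big_sumType /= -big_split /=.
  apply: dvdp_mul; apply: dvdp_prod => i; last by rewrite dvdp_exp2l ?alg_mult_le.
  by apply: dvdp_mul; rewrite dvdp_exp2l ?alg_mult_le.
have HCfree : row_free HC by rewrite row_free_unit.
have Gfree := row_free_gram AH HCfree Xfree Xker cop_p dvd_p.
have Gunit : Xc^t* *m HC *m Xc \in unitmx := hermitian_gram_unitmx Xfree Xreal Gfree.
split=> //.
have [Dreal DH DX] := no_spillover_perturbation HCorth HCreal eps2 HCsym Xreal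
  Gunit Freal FH FX.
have [DA DAE] := real_mxP Dreal.
exists DA; split; first exact: esym.
- by apply/(structuredE _ Horth); rewrite -DAE.
- by rewrite -DAE; apply/XL.
- move=> x s Y [_ _ _ AY]; rewrite -DAE mulmxDl AY.
  (* The perturbation ends in the factor [Xc^t* *m HC], so it annihilates every chain [H]-orthogonal
     to [Xc]. *)
  suff XHY : Xc^t* *m HC *m Y = 0 by rewrite -!mulmxA in XHY *; rewrite XHY !mulmx0 addr0.
  apply: (jordan_chain_orthogonal AH _ (root_p x) AY).
  by rewrite -Xker -map_trmx.
Qed.
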